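(* Let $G$ and $H$ be \textsc{Nim} positions with $G=H$ (equality in the partizan mis\`ere sense, i.e. $o^{-}(G+X)=o^{-}(H+X)$ for all games $X$, partizan games included). Then $G\cong H$, i.e. $G$ and $H$ are isomorphic.
   Context: All games are short two-player (possibly partizan) games between Left and Right: they have finitely many distinct subpositions and admit no infinite runs. A game is given by its set of Left options and its set of Right options (several moves leading to isomorphic positions are not distinguished). $G\cong H$ (isomorphic) means that the game trees of $G$ and $H$ are isomorphic. $G+H$ is the disjunctive sum: a player moves in exactly one of the components. Play is mis\`ere: a player who has no move on their turn wins. $o^{-}(G)\in\{\mathcal{L},\mathcal{R},\mathcal{P},\mathcal{N}\}$ is the mis\`ere outcome of $G$, according to whether Left, Right, the Previous (second) player, or the Next (first) player has a winning strategy. For games $G,H$, $G=H$ means $o^{-}(G+X)=o^{-}(H+X)$ for all (short, possibly partizan) games $X$. A Nim heap of size $n$ (a natural number) is the game whose options, for both players, are the Nim heaps of size $m$ with $0\le m<n$. A \textsc{Nim} position is a disjunctive sum of finitely many Nim heaps. Every \textsc{Nim} position is determined up to isomorphism by the multiset of its nonzero heap sizes, and is identified (up to isomorphism) with the finite nondecreasing sequence of its positive heap sizes; the empty sequence $(\cdot)$ corresponds to the zero position $0$. *)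

(* Defs.v *)
From mathcomp Require Import all_boot.
Set Implicit Arguments.
Unset Strict Implicit.
Unset Printing Implicit Defensive.

(* A short partizan game.  The option lists stand for finite sets: order and
   repetitions are irrelevant, and are discarded by [iso] below. *)
Inductive game : Type := Game of seq game & seq game.

Inductive player : Type := Left | Right.

Definition opponent (p : player) : player :=
  match p with Left => Right | Right => Left end.

Definition zero : game := Game [::] [::].

(* Isomorphism of game trees in which several moves to isomorphic positions
   count as one: the two sets of Left options, and the two sets of Right
   options, agree up to isomorphism. *)
Fixpoint iso (G H : game) {struct G} : bool :=
  let: Game GL GR := G in
  let: Game HL HR := H in
  [&& all (fun g => has (fun h => iso g h) HL) GL,
      all (fun h => has (fun g => iso g h) GL) HL,
      all (fun g => has (fun h => iso g h) HR) GR
    & all (fun h => has (fun g => iso g h) GR) HR].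

Fixpoint add (G : game) : game -> game :=
  let: Game GL GR := G in
  fix addG (H : game) : game :=
    let: Game HL HR := H in
    Game ([seq add g H | g <- GL] ++ [seq addG h | h <- HL])
         ([seq add g H | g <- GR] ++ [seq addG h | h <- HR]).

(* [wins p q G]: player [p] has a winning strategy in misere play on [G] when
   it is [q]'s turn.  A player who has no move on their turn wins. *)
Fixpoint wins (p q : player) (G : game) {struct G} : bool :=
  let: Game Ls Rs := G in
  match p, q with
  | Left, Left => nilp Ls || has (wins Left Right) Ls
  | Left, Right => ~~ nilp Rs && all (wins Left Left) Rs
  | Right, Right => nilp Rs || has (wins Right Left) Rs
  | Right, Left => ~~ nilp Ls && all (wins Right Right) Ls
  end.

Inductive outcome : Type := OutL | OutR | OutP | OutN.

(* The last branch is the remaining case, in which the second player wins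
   whoever starts; see [misere_outcomeP]. *)
Definition misere_outcome (G : game) : outcome :=
  if wins Left Left G && wins Left Right G then OutL
  else if wins Right Left G && wins Right Right G then OutR
  else if wins Left Left G && wins Right Right G then OutN
  else OutP.

Definition misere_eq (G H : game) : Prop :=
  forall X : game, misere_outcome (add G X) = misere_outcome (add H X).

Fixpoint nim_heaps (n : nat) : seq game :=
  if n is m.+1 then
    rcons (nim_heaps m) (Game (nim_heaps m) (nim_heaps m))
  else [::].

Definition nim_heap (n : nat) : game := Game (nim_heaps n) (nim_heaps n).

Definition nim_sum (s : seq nat) : game :=
  foldr (fun n G => add (nim_heap n) G) zero s.

Definition nim_position (G : game) : Prop :=
  exists s : seq nat, iso G (nim_sum s).

Lemma nim_heapsE n : nim_heaps n = [seq nim_heap m | m <- iota 0 n].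
Proof. by elim: n => // n IHn; rewrite -addn1 iotaD map_cat -IHn addn1 /= cats1. Qed.

Lemma wins_opponent p q G : wins (opponent p) q G = ~~ wins p q G.
Proof.
move: G p q; fix IH 1 => -[Ls Rs].
have E p q s : all (fun G => wins (opponent p) q G == ~~ wins p q G) s ->
    has (wins (opponent p) q) s = ~~ all (wins p q) s
    /\ all (wins (opponent p) q) s = ~~ has (wins p q) s.
  elim: s => //= G s IHs /andP[/eqP-> /IHs[-> ->]].
  by rewrite negb_and negb_or.
have A p q : all (fun G => wins (opponent p) q G == ~~ wins p q G) Ls.
  elim: Ls => //= G s IHs; rewrite IHs andbT; apply/eqP; exact: IH.
have B p q : all (fun G => wins (opponent p) q G == ~~ wins p q G) Rs.
  elim: Rs => //= G s IHs; rewrite IHs andbT; apply/eqP; exact: IH.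
case=> -[] /=.
- by rewrite negb_or (E _ _ _ (A Left Right)).2.
- by rewrite negb_and negbK (E _ _ _ (B Left Left)).1.
- by rewrite negb_and negbK (E _ _ _ (A Right Right)).1.
- by rewrite negb_or (E _ _ _ (B Right Left)).2.
Qed.

Lemma misere_outcomeP (G : game) :
  match misere_outcome G with
  | OutL => wins Left Left G && wins Left Right G
  | OutR => wins Right Left G && wins Right Right G
  | OutP => wins Left Right G && wins Right Left G
  | OutN => wins Left Left G && wins Right Right G
  end.
Proof.
have E q : wins Right q G = ~~ wins Left q G := wins_opponent Left q G.
rewrite /misere_outcome !E.
by case: (wins Left Left G); case: (wins Left Right G).
Qed.

(* Main.v *)
(** Adapting Siegel's analysis of the partizan misere order, one shows by
    induction on size that two non-isomorphic Nim positions are told apart by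
    some game X, whichever player starts.  If an option B' of B is neither
    isomorphic to an option of A nor has an option isomorphic to A, then the
    distinguishing games of the smaller pairs (A', B') and (A, B'') are glued
    into a game T such that Left, moving first, loses on A + T but wins on
    B + T by moving to B' + T.  Such an option exists, up to exchanging A and B,
    because the sizes of the options of a Nim position have no gaps (see
    [nim_mismatch]), unless exactly one of A and B is the zero position, which
    is handled directly. *)
Require Import Defs.
From HB Require Import structures.
From mathcomp Require Import all_boot zify.
Set Implicit Arguments.
Unset Strict Implicit.
Unset Printing Implicit Defensive.

(** * Structural equality and induction on games *)

Fixpoint game_encode (G : game) : GenTree.tree unit :=
  let: Game L R := G in
  GenTree.Node 0 [:: GenTree.Node 0 (map game_encode L);
                     GenTree.Node 0 (map game_encode R)].

Fixpoint game_decode (t : GenTree.tree unit) : option game :=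
  if t is GenTree.Node _ [:: GenTree.Node _ L; GenTree.Node _ R]
  then Some (Game (pmap game_decode L) (pmap game_decode R)) else None.

(** This retraction carries the decidable equality of trees over to games, so that [\in] applies to
    option lists. That equality is finer than [iso]. *)
Lemma game_encodeK : pcancel game_encode game_decode.
Proof.
rewrite /pcancel; fix IH 1 => -[L R] /=; congr (Some (Game _ _)).
- by elim: L => //= G L IHL; rewrite IH /= IHL.
- by elim: R => //= G R IHR; rewrite IH /= IHR.
Qed.

HB.instance Definition _ := Equality.copy game (pcan_type game_encodeK).

Definition lefts (G : game) := let: Game L _ := G in L.
Definition rights (G : game) := let: Game _ R := G in R.

(** Options sit inside lists, so the generated induction principle gives no hypothesis about
    them. *)
Lemma game_ind_in (P : game -> Prop) :
  (forall L R : seq game, {in L, forall G, P G} -> {in R, forall G, P G} ->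
    P (Game L R)) ->
  forall G, P G.
Proof.
move=> IHP; fix IH 1 => -[L R]; apply: IHP.
- elim: L => [|G L IHL] H; first by clear IH.
  by rewrite inE => /predU1P[->|/IHL]; [exact: IH | apply].
- elim: R => [|G R IHR] H; first by clear IH.
  by rewrite inE => /predU1P[->|/IHR]; [exact: IH | apply].
Qed.

(** * Isomorphism and its compatibility with sums *)

Lemma isoP (G H : game) :
  reflect [/\ {in lefts G, forall g, exists2 h, h \in lefts H & iso g h},
              {in lefts H, forall h, exists2 g, g \in lefts G & iso g h},
              {in rights G, forall g, exists2 h, h \in rights H & iso g h}
            & {in rights H, forall h, exists2 g, g \in rights G & iso g h}]
          (iso G H).
Proof.
case: G H => [GL GR] [HL HR].
apply: (iffP and4P) => -[/= A B C D]; split=> /=.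
- by move=> g /(allP A)/hasP.
- by move=> g /(allP B)/hasP.
- by move=> g /(allP C)/hasP.
- by move=> g /(allP D)/hasP.
- by apply/allP => g /A; move/hasP.
- by apply/allP => g /B; move/hasP.
- by apply/allP => g /C; move/hasP.
- by apply/allP => g /D; move/hasP.
Qed.

Lemma iso_sym G H : iso G H -> iso H G.
Proof.
elim/game_ind_in: G H => L R IHL IHR H /isoP[/= A B C D].
apply/isoP; split=> /= h.
- by move=> /B[g gL /(IHL _ gL)]; exists g.
- by move=> gL; have [g hH /(IHL _ gL)] := A _ gL; exists g.
- by move=> /D[g gL /(IHR _ gL)]; exists g.
- by move=> gL; have [g hH /(IHR _ gL)] := C _ gL; exists g.
Qed.

Lemma iso_trans H G K : iso G H -> iso H K -> iso G K.
Proof.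
elim/game_ind_in: G H K => L R IHL IHR H K /isoP[A B C D].
move=> /isoP[A' B' C' D']; apply/isoP; split=> /= x.
- move=> xG; have [h hH xh] := A _ xG; have [k kK hk] := A' _ hH.
  by exists k => //; apply: IHL xh hk.
- move=> /B'[h /B[g gG gh] hk].
  by exists g => //; apply: IHL gh hk.
- move=> xG; have [h hH xh] := C _ xG; have [k kK hk] := C' _ hH.
  by exists k => //; apply: IHR xh hk.
- move=> /D'[h /D[g gG gh] hk].
  by exists g => //; apply: IHR gh hk.
Qed.

Lemma lefts_add G X :
  lefts (add G X) = [seq add g X | g <- lefts G] ++ [seq add G x | x <- lefts X].
Proof. by case: G X => [? ?] [? ?]. Qed.

Lemma rights_add G X :
  rights (add G X) =
    [seq add g X | g <- rights G] ++ [seq add G x | x <- rights X].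
Proof. by case: G X => [? ?] [? ?]. Qed.

Lemma iso_add G H X : iso G H -> iso (add G X) (add H X).
Proof.
elim/game_ind_in: G H X => L R IHL IHR H X isoGH.
have [/= A B C D] := isoP _ _ isoGH.
elim/game_ind_in: X => XL XR IHXL IHXR.
apply/isoP; rewrite !lefts_add !rights_add; split=> x.
- rewrite mem_cat => /orP[]/mapP[y y_in ->].
    have [h hH yh] := A _ y_in.
    exists (add h (Game XL XR)); last exact: IHL.
    by rewrite mem_cat (map_f (add^~ _)).
  exists (add H y); last exact: IHXL.
  by rewrite mem_cat orbC map_f.
- rewrite mem_cat => /orP[]/mapP[y y_in ->].
    have [g gG gy] := B _ y_in.
    exists (add g (Game XL XR)); last exact: IHL.
    by rewrite mem_cat (map_f (add^~ _)).
  exists (add (Game L R) y); last exact: IHXL.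
  by rewrite mem_cat orbC map_f.
- rewrite mem_cat => /orP[]/mapP[y y_in ->].
    have [h hH yh] := C _ y_in.
    exists (add h (Game XL XR)); last exact: IHR.
    by rewrite mem_cat (map_f (add^~ _)).
  exists (add H y); last exact: IHXR.
  by rewrite mem_cat orbC map_f.
- rewrite mem_cat => /orP[]/mapP[y y_in ->].
    have [g gG gy] := D _ y_in.
    exists (add g (Game XL XR)); last exact: IHR.
    by rewrite mem_cat (map_f (add^~ _)).
  exists (add (Game L R) y); last exact: IHXR.
  by rewrite mem_cat orbC map_f.
Qed.

(** * Misere winning conditions, their invariance and their form on sums *)

Lemma wins_LL G :
  wins Left Left G = nilp (lefts G) || has (wins Left Right) (lefts G).
Proof. by case: G. Qed.

Lemma wins_LR G :
  wins Left Right G = ~~ nilp (rights G) && all (wins Left Left) (rights G).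
Proof. by case: G. Qed.

Lemma nilpPn (T : eqType) (s : seq T) : reflect (exists x, x \in s) (~~ nilp s).
Proof.
case: s => [|x s]; constructor; last by exists x; rewrite mem_head.
by case=> x; rewrite in_nil.
Qed.

Lemma iso_wins q G H : iso G H -> wins Left q G = wins Left q H.
Proof.
suff sub A B : iso A B -> forall q, wins Left q A -> wins Left q B.
  by move=> GH; apply/idP/idP; apply: sub => //; apply: iso_sym.
elim/game_ind_in: A B => L R IHL IHR B /isoP[/= A1 A2 A3 A4] [].
  rewrite !wins_LL => /orP[|/hasP[g gL wg]].
    move/nilP=> L0; apply/orP; left; apply: contraT => /nilpPn[h /A2[g]].
    by rewrite /= in L0; rewrite L0.
  have [h hB gh] := A1 _ gL.
  by apply/orP; right; apply/hasP; exists h => //; apply: IHL gh _ wg.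
rewrite !wins_LR => /andP[/nilpPn[g /A3[h hB _]] /allP wR].
apply/andP; split; first by apply/nilpPn; exists h.
apply/allP => k /A4[r rR rk]; exact: IHR rk _ (wR _ rR).
Qed.

(** Right wins exactly when Left does not, so the four outcomes encode the four pairs of results for
    Left. *)
Lemma misere_eq_wins G H : misere_eq G H ->
  forall q X, wins Left q (add G X) = wins Left q (add H X).
Proof.
move=> eqGH q X; have := eqGH X; rewrite /misere_outcome.
have E r K : wins Right r K = ~~ wins Left r K := wins_opponent Left r K.
rewrite !E.
by case: q; do 4!case: (wins _ _ _).
Qed.

Lemma wins_LL_addP G X :
  reflect [\/ nilp (lefts G) && nilp (lefts X),
              exists2 g, g \in lefts G & wins Left Right (add g X)
            | exists2 x, x \in lefts X & wins Left Right (add G x)]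
          (wins Left Left (add G X)).
Proof.
rewrite wins_LL lefts_add has_cat !has_map /nilp size_cat !size_map addn_eq0.
apply: (iffP or3P) => -[H|/hasP H|/hasP H];
  by [constructor 1 | constructor 2 | constructor 3].
Qed.

Lemma wins_LR_addP G X :
  reflect [/\ ~~ (nilp (rights G) && nilp (rights X)),
              {in rights G, forall g, wins Left Left (add g X)}
            & {in rights X, forall x, wins Left Left (add G x)}]
          (wins Left Right (add G X)).
Proof.
rewrite wins_LR rights_add all_cat !all_map /nilp size_cat !size_map addn_eq0.
by apply: (iffP and3P) => -[H /allP A /allP B]; split.
Qed.

(** * Impartial games and their adjoints *)

(** Equality of the two lists, rather than matching up to [iso], lets the Right options be rewritten
    as the Left ones; Nim positions satisfy it by construction. *)
Fixpoint impartial (G : game) : bool :=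
  let: Game L R := G in (L == R) && all impartial L.

Lemma impartial_rights G : impartial G -> rights G = lefts G.
Proof. by case: G => L R /= /andP[/eqP]. Qed.

Lemma impartial_lefts G G' : impartial G -> G' \in lefts G -> impartial G'.
Proof. by case: G => L R /= /andP[_ /allP]; apply. Qed.

Lemma impartial_add G H : impartial G -> impartial H -> impartial (add G H).
Proof.
elim/game_ind_in: G H => L R IHL _ H impG.
elim/game_ind_in: H => HL HR IHH _ impH.
have /= eqRL := impartial_rights impG; have /= eqHR := impartial_rights impH.
rewrite {}eqRL {}eqHR in impG impH IHH *; rewrite /= eqxx all_cat !all_map.
apply/and3P; split=> //; apply/allP => g g_in.
  by apply: IHL => //; apply: impartial_lefts impG _.
exact: IHH _ g_in (impartial_lefts impH g_in).
Qed.

Definition star : game := Game [:: zero] [:: zero].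

(** The misere substitute for a negative. An end is sent to [star], since zero plus zero is won by
    the player to move. *)
Fixpoint adjoint (G : game) : game :=
  let: Game L _ := G in
  if nilp L then star else Game (map adjoint L) (map adjoint L).

(** Pairing strategy: a move to [g] or to [adjoint g] is answered by the other one in the other
    component. *)
Lemma adjoint_second_player_wins G (impG : impartial G) :
  ~~ wins Left Left (add G (adjoint G)) && wins Left Right (add G (adjoint G)).
Proof.
elim/game_ind_in: G impG => L R IH _ impG.
have eqRL : R = L := impartial_rights impG.
have {}IH g (gL : g \in L) := andP (IH g gL (impartial_lefts impG gL)).
have [/nilP L0|Ln0] := boolP (nilp L); first by rewrite eqRL L0.
set G := Game L R.
have lA : lefts (adjoint G) = map adjoint L by rewrite /= (negPf Ln0).
have rA : rights (adjoint G) = map adjoint L by rewrite /= (negPf Ln0).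
apply/andP; split.
  apply/negP => /wins_LL_addP; rewrite lA => -[|[g gL]|[_ /mapP[g gL ->]]].
  - by rewrite /= (negPf Ln0).
  - case/wins_LR_addP => _ _ /(_ (adjoint g)).
    by rewrite rA map_f // => /(_ isT); apply/negP; case: (IH g gL).
  - case/wins_LR_addP => _ /(_ g).
    by rewrite /= eqRL => /(_ gL) w _; move: w; apply/negP; case: (IH g gL).
apply/wins_LR_addP; rewrite rA [rights G]eqRL; split.
- by rewrite (negPf Ln0).
- move=> g gL; apply/wins_LL_addP; constructor 3.
  by exists (adjoint g); rewrite ?lA ?map_f //; case: (IH g gL).
- move=> _ /mapP[g gL ->]; apply/wins_LL_addP; constructor 2.
  by exists g => //; case: (IH g gL).
Qed.

(** * Separating games *)

(* A witness that [A >= B] fails in the misere order, with player [q] to move. *)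
Definition separable (q : player) (A B : game) : Prop :=
  exists2 X, wins Left q (add B X) & ~~ wins Left q (add A X).

(** In [V] Right can only move to [U]; if Right moves to [b] in [B] instead, Left answers with
    [adjoint b]. *)
Lemma separable_LR A B :
  impartial B -> separable Left A B -> separable Right A B.
Proof.
move=> impB [U BU AU]; pose V := Game (map adjoint (lefts B)) [:: U].
exists V.
  apply/wins_LR_addP; split; first by rewrite andbF.
    move=> b; rewrite impartial_rights // => bB.
    apply/wins_LL_addP; constructor 3; exists (adjoint b); first by rewrite map_f.
    by case/andP: (adjoint_second_player_wins (impartial_lefts impB bB)).
  by move=> _ /[!inE] /eqP->.
apply: contra AU => /wins_LR_addP[_ _]; apply; exact: mem_head.
Qed.

(** Dually, Left should move from [U] to [V]; a Left move to [a] in [A] is punished by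
    [adjoint a]. *)
Lemma separable_RL A B :
  impartial A -> separable Right A B -> separable Left A B.
Proof.
move=> impA [V BV AV]; pose U := Game [:: V] (map adjoint (lefts A)).
exists U.
  by apply/wins_LL_addP; constructor 3; exists V; rewrite ?mem_head.
apply/negP => /wins_LL_addP[|[a aA]|[x]].
- by rewrite andbF.
- case/wins_LR_addP => _ _ /(_ (adjoint a)) /[!map_f] // /(_ isT).
  by apply/negP; case/andP: (adjoint_second_player_wins (impartial_lefts impA aA)).
- by rewrite inE => /eqP->; apply/negP.
Qed.

(** The second half excludes surplus entries: [t] will serve as an option list, where each extra
    move could spoil a strategy. *)
Lemma finite_choice (T U : eqType) (P : T -> U -> Prop) (s : seq T) :
  {in s, forall x, exists y, P x y} ->
  exists t : seq U, {in s, forall x, exists2 y, y \in t & P x y} /\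
                    {in t, forall y, exists2 x, x \in s & P x y}.
Proof.
elim: s => [|x s IHs] Ps; first by exists [::].
have [|t [st ts]] := IHs; first by move=> z zs; apply: Ps; rewrite inE zs orbT.
have [y Pxy] := Ps x (mem_head _ _).
exists (y :: t); split=> z; rewrite inE => /predU1P[->|].
- by exists y; rewrite ?mem_head.
- by case/st => w wt; exists w; rewrite // inE wt orbT.
- by exists x; rewrite ?mem_head.
- by case/ts => w wt; exists w; rewrite // inE wt orbT.
Qed.

(* [T] lets Left move to the games separating [A] from options of [B], and
   Right to those separating options of [A] from [B]: every move in [A] (by
   Left) or in [B] (by Right) is answered in [T].  When [A] and [B] are both
   zero this [T] would be zero too, which is wrong in misere play; [star]
   replaces it. *)
Lemma downlinked A B : impartial A -> impartial B ->
  {in lefts A, forall a, separable Left a B} ->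
  {in lefts B, forall b, separable Right A b} ->
  exists2 T, ~~ wins Left Left (add A T) & wins Left Right (add B T).
Proof.
move=> impA impB sepA sepB.
have [/andP[A0 B0]|AB0] := boolP (nilp (lefts A) && nilp (lefts B)).
  have /(congr1 size)/= := impartial_rights impA.
  have /(congr1 size)/= := impartial_rights impB.
  case: A B A0 B0 {impA impB sepA sepB} => [L R] [L' R'] /= /nilP-> /nilP->.
  by move=> /size0nil-> /size0nil->; exists star.
have [Us [AU UA]] := finite_choice (P := fun a U =>
  wins Left Left (add B U) && ~~ wins Left Left (add a U))
  (fun a aA => let: ex_intro2 X p q := sepA a aA in
     ex_intro _ X (introT andP (conj p q))).
have [Vs [BV VB]] := finite_choice (P := fun b V =>
  wins Left Right (add b V) && ~~ wins Left Right (add A V))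
  (fun b bB => let: ex_intro2 X p q := sepB b bB in
     ex_intro _ X (introT andP (conj p q))).
(* A stuck player wins, so Left on [A + T] and Right on [B + T] must have a move. An option of [A]
   yields an entry of [Us], one of [B] an entry of [Vs]. *)
have ends : ~~ (nilp (lefts A) && nilp Vs) /\ ~~ (nilp (lefts B) && nilp Us).
  move: AB0; rewrite !negb_and => /orP[]/nilpPn[x x_in]; split; apply/orP.
  - by left; apply/nilpPn; exists x.
  - by have [U UUs _] := AU _ x_in; right; apply/nilpPn; exists U.
  - by have [V VVs _] := BV _ x_in; right; apply/nilpPn; exists V.
  - by left; apply/nilpPn; exists x.
exists (Game Vs Us).
  apply/negP => /wins_LL_addP[|[a aA]|[V VVs]].
  - by apply/negP; case: ends.
  - case/wins_LR_addP => _ _ win; have [U UUs /andP[_]] := AU _ aA.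
    by rewrite win.
  - by have [b _ /andP[_ /negPf->]] := VB _ VVs.
apply/wins_LR_addP; rewrite impartial_rights //=; split; first by case: ends.
- move=> b bB; have [V VVs /andP[bV _]] := BV _ bB.
  by apply/wins_LL_addP; constructor 3; exists V.
- by move=> U /UA[a _ /andP[]].
Qed.

(** Right, without any move in the witness, is stuck next to [A] and so wins; next to [B], Right
    must move to some [b], met by [adjoint b]. *)
Lemma separable_end_l A B : impartial A -> impartial B ->
  nilp (lefts A) -> ~~ nilp (lefts B) -> separable Right A B.
Proof.
move=> impA impB A0 B0; exists (Game (map adjoint (lefts B)) [::]).
  apply/wins_LR_addP; rewrite impartial_rights //=.
  split=> //; first by rewrite andbT.
  move=> b bB; apply/wins_LL_addP; constructor 3.
  exists (adjoint b); first by rewrite map_f.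
  by case/andP: (adjoint_second_player_wins (impartial_lefts impB bB)).
by apply/negP => /wins_LR_addP[]; rewrite impartial_rights // A0.
Qed.

Lemma separable_end_r A B : impartial A -> impartial B ->
  ~~ nilp (lefts A) -> nilp (lefts B) -> separable Left A B.
Proof.
move=> impA impB A0 B0; exists (Game [::] (map adjoint (lefts A))).
  by apply/wins_LL_addP; constructor 1; rewrite B0.
apply/negP => /wins_LL_addP[|[a aA]|[x]] //; first by rewrite (negPf A0).
case/wins_LR_addP => _ _ /(_ (adjoint a)) /[!map_f] // /(_ isT).
by apply/negP; case/andP: (adjoint_second_player_wins (impartial_lefts impA aA)).
Qed.

(** * Nim positions, their sizes and their options *)

Lemma impartial_nim_heap n : impartial (nim_heap n).
Proof.
elim/ltn_ind: n => n IHn; rewrite /= eqxx nim_heapsE all_map.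
by apply/allP => m; rewrite mem_iota => /IHn.
Qed.

Lemma impartial_nim_sum s : impartial (nim_sum s).
Proof.
by elim: s => // n s; apply: impartial_add; apply: impartial_nim_heap.
Qed.

Lemma mem_lefts_nim n s G :
  (G \in lefts (nim_sum (n :: s))) <->
  (exists2 m, m < n & G = nim_sum (m :: s)) \/
  (exists2 H, H \in lefts (nim_sum s) & G = add (nim_heap n) H).
Proof.
rewrite -[nim_sum (n :: s)]/(add (nim_heap n) (nim_sum s)) lefts_add mem_cat.
rewrite [lefts (nim_heap n)]/= nim_heapsE -map_comp.
split=> [/orP[/mapP[m] /[!mem_iota] ? ->|/mapP[H Hs ->]]|].
- by left; exists m.
- by right; exists H.
- case=> -[x x_in ->]; apply/orP; [left|right].
    by apply/mapP; exists x; rewrite // mem_iota.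
  by rewrite map_f.
Qed.

(** An option lowers one heap; lowering the same heap by less reaches every intermediate size. *)
Lemma lefts_nim s G : G \in lefts (nim_sum s) ->
  exists t, [/\ G = nim_sum t, sumn t < sumn s
    & forall k, sumn t <= k < sumn s ->
        exists2 u, nim_sum u \in lefts (nim_sum s) & sumn u = k].
Proof.
elim: s G => // n s IHs G /mem_lefts_nim[[m mn ->]|[H /IHs[t [-> ts gap]] ->]].
  exists (m :: s); split=> //= [|k kP]; first by rewrite ltn_add2r.
  exists (k - sumn s :: s); last by rewrite /=; lia.
  by apply/mem_lefts_nim; left; exists (k - sumn s) => //; lia.
exists (n :: t); split=> //= [|k kP]; first by rewrite ltn_add2l.
have [|u us uk] := gap (k - n); first lia.
exists (n :: u); last by rewrite /= uk; lia.
by apply/mem_lefts_nim; right; exists (nim_sum u).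
Qed.

Lemma nim_pred s : 0 < sumn s ->
  exists2 t, nim_sum t \in lefts (nim_sum s) & sumn t = (sumn s).-1.
Proof.
elim: s => //= -[|n] s IHs /= s0.
  have [t ts tE] := IHs s0; exists (0 :: t) => //.
  by apply/(mem_lefts_nim 0); right; exists (nim_sum t).
by exists (n :: s) => //; apply/(mem_lefts_nim n.+1); left; exists n.
Qed.

Lemma nilp_nim s : nilp (lefts (nim_sum s)) = (sumn s == 0).
Proof.
apply/idP/idP => [|/eqP s0].
  apply: contraLR; rewrite -lt0n => /nim_pred[t ts _].
  by apply/nilpPn; exists (nim_sum t).
by apply: contraT => /nilpPn[G /lefts_nim[t []]]; rewrite s0.
Qed.

Lemma impartial_iso G H : impartial G -> impartial H ->
  {in lefts G, forall g, exists2 h, h \in lefts H & iso g h} ->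
  {in lefts H, forall h, exists2 g, g \in lefts G & iso g h} -> iso G H.
Proof. by move=> impG impH GH HG; apply/isoP; rewrite !impartial_rights. Qed.

(** Induction along options of size one less, which [nim_pred] provides. *)
Lemma iso_sumn s t : iso (nim_sum s) (nim_sum t) -> sumn s = sumn t.
Proof.
suff le : forall s t, iso (nim_sum s) (nim_sum t) -> sumn s <= sumn t.
  by move=> st; apply/eqP; rewrite eqn_leq !le // iso_sym.
move=> {}s {}t; have [n] := ubnP (sumn s).
elim: n => // n IHn in s t * => sn /isoP[st _ _ _].
have [->//|s0] := posnP (sumn s).
have [s' /st[G /lefts_nim[t' [-> t't _]] iso'] s'E] := nim_pred s0.
have := IHn s' t' _ iso'; lia.
Qed.

(* The sizes of the options of a position fill an interval.  If [A] is smaller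
   than [B], some option of [A] has size |A| - 1; if it is isomorphic to an
   option of [B], then [B] also has an option of size |A|, which is too large
   for an option of [A] and too small to have an option isomorphic to [A]. *)
Lemma nim_mismatch s t (A := nim_sum s) (B := nim_sum t) : sumn s <= sumn t ->
  ~~ iso A B -> nilp (lefts A) = nilp (lefts B) ->
  (exists2 a, a \in lefts A & ~~ has (iso a) (lefts B) &&
                              ~~ has (iso^~ B) (lefts a)) \/
  (exists2 b, b \in lefts B & ~~ has (iso^~ b) (lefts A) &&
                              ~~ has (iso A) (lefts b)).
Proof.
move=> le_st nisoAB ends.
have [/hasP[a aA aP]|/hasPn noA] := boolP (has (fun a =>
    ~~ has (iso a) (lefts B) && ~~ has (iso^~ B) (lefts a)) (lefts A)).
  by left; exists a.
have [/hasP[b bB bP]|/hasPn noB] := boolP (has (fun b =>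
    ~~ has (iso^~ b) (lefts A) && ~~ has (iso A) (lefts b)) (lefts B)).
  by right; exists b.
have {}noA a : a \in lefts A -> exists2 b, b \in lefts B & iso a b.
  (* An option of [a] is smaller than [A], hence than [B], so it cannot be isomorphic to [B]. *)
  move=> aA; have := noA a aA; rewrite negb_and !negbK => /orP[/hasP//|/hasP[c]].
  have [s' [-> s's _]] := lefts_nim aA => /lefts_nim[c' [-> c's' _]] /iso_sumn.
  lia.
case: (ltngtP (sumn s) (sumn t)) le_st => // [lt_st|eq_st] _.
  have s0 : 0 < sumn s.
    by rewrite lt0n -nilp_nim ends nilp_nim; lia.
  have [s' s'A s'E] := nim_pred s0.
  have [_ /lefts_nim[t' [-> _ gap]] /iso_sumn eq'] := noA _ s'A.
  have [|u uB uE] := gap (sumn s); first lia.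
  have := noB _ uB; rewrite negb_and !negbK => /orP[]/hasP[c].
    by move=> /lefts_nim[c' [-> c's _]] /iso_sumn; lia.
  by move=> /lefts_nim[c' [-> c's _]] /iso_sumn; lia.
(* With equal sizes, the same comparison matches every option of [B] too. *)
case/negP: nisoAB; apply: impartial_iso => [|||b bB].
- exact: impartial_nim_sum.
- exact: impartial_nim_sum.
- by move=> a /noA.
have := noB b bB; rewrite negb_and !negbK => /orP[/hasP//|/hasP[c]].
have [t' [-> t't _]] := lefts_nim bB => /lefts_nim[c' [-> c't' _]] /iso_sumn.
lia.
Qed.

(** * Separation of non-isomorphic Nim positions *)

Lemma nim_separable q s t :
  ~~ iso (nim_sum s) (nim_sum t) -> separable q (nim_sum s) (nim_sum t).
Proof.
have [n] := ubnP (sumn s + sumn t).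
elim: n => // n IHn in q s t *; rewrite ltnS => stn niso.
set A := nim_sum s; set B := nim_sum t.
have impA : impartial A := impartial_nim_sum s.
have impB : impartial B := impartial_nim_sum t.
suff : separable Left A B \/ separable Right A B.
  case: q => -[] // sepAB; [exact: separable_RL | exact: separable_LR].
have [A0|A0] := boolP (nilp (lefts A)); have [B0|B0] := boolP (nilp (lefts B)).
- case/negP: niso; apply: impartial_iso => // [a|b].
    by rewrite (nilP A0).
  by rewrite (nilP B0).
- by right; apply: separable_end_l.
- by left; apply: separable_end_r.
have ends : nilp (lefts A) = nilp (lefts B) by rewrite (negPf A0) (negPf B0).
have : (exists2 a, a \in lefts A & ~~ has (iso a) (lefts B) &&
                                   ~~ has (iso^~ B) (lefts a)) \/
       (exists2 b, b \in lefts B & ~~ has (iso^~ b) (lefts A) &&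
                                   ~~ has (iso A) (lefts b)).
  (* The mismatch lemma wants the smaller position first; otherwise the roles and the two
     alternatives are swapped. *)
  have [le_st|/ltnW le_ts] := leqP (sumn s) (sumn t).
    exact: nim_mismatch.
  have symE G : iso G =1 iso^~ G by move=> H; apply/idP/idP; apply: iso_sym.
  have nisoC : ~~ iso B A by rewrite symE.
  have := nim_mismatch le_ts nisoC (esym ends).
  case=> -[x x_in]; [right|left]; exists x => //.
    by rewrite -(eq_has (symE x)) (eq_has (symE A)).
  by rewrite (eq_has (symE x)) -(eq_has (symE B)).
case=> -[x x_in /andP[/hasPn no1 /hasPn no2]].
  (* Right, moving first on [A + T], goes to [x + T], where Left loses; on [B + T] Left wins. *)
  right; have [s' [xE s's _]] := lefts_nim x_in.
  have [||||T xT BT] := @downlinked x B.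
  - exact: impartial_lefts x_in.
  - by [].
  - move=> y /[dup] yx /no2; rewrite xE in yx.
    by have [u [-> us' _]] := lefts_nim yx; apply: IHn; lia.
  - move=> y /[dup] yB /no1.
    by have [u [-> ut _]] := lefts_nim yB; rewrite xE; apply: IHn; lia.
  exists T => //; apply/negP => /wins_LR_addP[_ /(_ x)].
  by rewrite impartial_rights // (negPf xT) => /(_ x_in).
(* Left, moving first, loses on [A + T] but wins on [B + T] by moving to [x + T]. *)
left; have [t' [xE t't _]] := lefts_nim x_in.
have [||||T AT xT] := @downlinked A x.
- by [].
- exact: impartial_lefts x_in.
- move=> y /[dup] yA /no1.
  by have [u [-> us _]] := lefts_nim yA; rewrite xE; apply: IHn; lia.
- move=> y /[dup] yx /no2; rewrite xE in yx.
  by have [u [-> ut' _]] := lefts_nim yx; apply: IHn; lia.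
by exists T => //; apply/wins_LL_addP; constructor 2; exists x.
Qed.

Theorem theorem4 (G H : game) (nimG : nim_position G) (nimH : nim_position H)
  (eqGH : misere_eq G H) : iso G H.
Proof.
have [s Gs] := nimG; have [t Ht] := nimH.
suff st : iso (nim_sum s) (nim_sum t).
  by apply: (iso_trans Gs); apply: (iso_trans st); apply: iso_sym.
apply: contraT => /(nim_separable Left)[X].
rewrite -(iso_wins _ (iso_add X Gs)) -(iso_wins _ (iso_add X Ht)).
by rewrite (misere_eq_wins eqGH) => ->.
Qed.
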